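(* Let $(X,X_+,\mathcal K,f)$ be an abstract state space and let $\mathcal S=(S_t)_{t\ge0}$, $\mathcal T=(T_t)_{t\ge0}$ be $C_0$-Markov semigroups on $X$ with generators $A$ and $C$, respectively, such that $A$ and $C$ have the same domain and $B:=C-A$ is bounded (i.e. extends to a bounded linear operator on $X$, again denoted $B$). Suppose there exist $\rho\in[0,1)$ and $t_0>0$ such that $\delta(T_{t_0})\le\rho$. Then for every $x,z\in\mathcal K$ and every $t>0$, $$\|A_t(\mathcal T)x-A_t(\mathcal S)z\|\le\bigg(\frac{t_0\big(1-\delta(T_{t_0})^{[t/t_0]}\big)}{1-\delta(T_{t_0})}+\delta(T_{t_0})^{[t/t_0]}\,(t-t_0[t/t_0])\bigg)\bigg(\|B\|+\frac{\|x-z\|}{t}\bigg),$$ where $[a]$ denotes the integer part of $a$.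
   Context: Abstract state space $(X,X_+,\mathcal K,f)$: $X$ is a real vector space ordered by a generating cone $X_+$ (so $X=X_+-X_+$), $f$ is a linear functional on $X$ with $f(x)>0$ for all $x\in X_+\setminus\{0\}$, and $\mathcal K=\{x\in X_+: f(x)=1\}$. Let $U$ be the convex hull of $\mathcal K\cup(-\mathcal K)$ and $\|x\|=\inf\{\lambda\ge0: x\in\lambda U\}$. It is assumed that $\|\cdot\|$ is a norm, that $X$ is complete for it, and that $X_+$ is closed. Norms of operators are operator norms. A linear operator $T:X\to X$ is Markov if it is positive ($Tx\ge0$ whenever $x\ge 0$) and $T(\mathcal K)\subset\mathcal K$. A $C_0$-Markov semigroup is a strongly continuous one-parameter semigroup $(T_t)_{t\ge0}$ on $X$ ($T_0=I$, $T_{t+s}=T_tT_s$, $\|T_tx-x\|\to0$ as $t\downarrow0$ for every $x\in X$) such that every $T_t$ is Markov. Averages: $A_t(\mathcal T)=\frac1t\int_0^tT_s\,ds$ for $t>0$, the integral being taken in the strong operator topology; similarly for $\mathcal S$. Dobrushin's ergodicity coefficient of a Markov operator $T$: with $N=\{x\in X: f(x)=0\}$, $\delta(T)=\sup_{x\in N,\,x\ne0}\|Tx\|/\|x\|$. The convention $0^0=1$ is used. *)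

(* Defs.v *)
From Stdlib Require Import Reals.
From Coquelicot Require Import Coquelicot.

Open Scope R_scope.

(* Algebraic linearity; Coquelicot's [is_linear] also requires boundedness. *)
Definition linear_map {U V : NormedModule R_AbsRing} (L : U -> V) : Prop :=
  (forall x y : U, L (plus x y) = plus (L x) (L y)) /\
  (forall (a : R) (x : U), L (scal a x) = scal a (L x)).

Section StateSpace.

Context {X : NormedModule R_AbsRing}.

Definition convex (C : X -> Prop) : Prop :=
  forall (x y : X) (a : R), C x -> C y -> 0 <= a <= 1 ->
    C (plus (scal a x) (scal (1 - a) y)).

Definition convex_hull (E : X -> Prop) : X -> Prop :=
  fun x => forall C : X -> Prop, convex C -> (forall y, E y -> C y) -> C x.

Definition is_cone (P : X -> Prop) : Prop :=
  P zero /\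
  (forall x y, P x -> P y -> P (plus x y)) /\
  (forall (a : R) x, 0 <= a -> P x -> P (scal a x)) /\
  (forall x, P x -> P (opp x) -> x = zero).

Definition generating (P : X -> Prop) : Prop :=
  forall x, exists y z, P y /\ P z /\ x = minus y z.

Definition base (P : X -> Prop) (f : X -> R) : X -> Prop :=
  fun x => P x /\ f x = 1.

Definition base_ball (P : X -> Prop) (f : X -> R) : X -> Prop :=
  convex_hull (fun x => base P f x \/ base P f (opp x)).

End StateSpace.

(* The norm, and with it completeness, is part of the carrier [X]; the last
   field says that this norm is the base norm given by [P] and [f]. *)
Record abstract_state_space (X : CompleteNormedModule R_AbsRing)
    (P : X -> Prop) (f : X -> R) : Prop := {
  ass_cone : is_cone P;
  ass_generating : generating P;
  ass_closed : closed P;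
  ass_linear : linear_map f;
  ass_pos : forall x, P x -> x <> zero -> 0 < f x;
  ass_norm : forall x : X,
    is_glb_Rbar
      (fun l => 0 <= l /\ exists u, base_ball P f u /\ x = scal l u)
      (Finite (norm x))
}.

Section Operators.

Context {X : NormedModule R_AbsRing}.

(* Norm of the restriction of [T] to [N].  If [N] has no nonzero element, the
   supremum of the empty set is [m_infty], which [real] sends to 0. *)
Definition op_norm_on (N : X -> Prop) (T : X -> X) : R :=
  real (Lub_Rbar (fun r =>
    exists x, N x /\ x <> zero /\ r = norm (T x) / norm x)).

Definition op_norm (T : X -> X) : R := op_norm_on (fun _ => True) T.

Definition dobrushin (f : X -> R) (T : X -> X) : R :=
  op_norm_on (fun x => f x = 0) T.

Definition markov (P : X -> Prop) (f : X -> R) (T : X -> X) : Prop :=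
  linear_map T /\
  (forall x, P x -> P (T x)) /\
  (forall x, base P f x -> base P f (T x)).

(* Only the values [T t] with [0 <= t] are meaningful. *)
Record C0_markov_semigroup (P : X -> Prop) (f : X -> R) (T : R -> X -> X)
    : Prop := {
  sg_markov : forall t, 0 <= t -> markov P f (T t);
  sg_zero : forall x, T 0 x = x;
  sg_add : forall t s x, 0 <= t -> 0 <= s -> T (t + s) x = T t (T s x);
  sg_cont : forall x,
    filterlim (fun t => norm (minus (T t x) x)) (at_right 0) (locally 0)
}.

End Operators.

(* Partially defined operator; the values of [app] outside [dom] are junk. *)
Record partial_op (X : NormedModule R_AbsRing) := PartialOp {
  dom : X -> Prop;
  app : X -> X
}.
Arguments dom {X} _ _.
Arguments app {X} _ _.

(* The graph of [A] is the set of pairs [(x, y)] such that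
   [(T h x - x) / h] tends to [y] in norm as [h] decreases to 0. *)
Definition is_generator {X : NormedModule R_AbsRing}
    (T : R -> X -> X) (A : partial_op X) : Prop :=
  forall x y : X,
    (dom A x /\ app A x = y) <->
    filterlim (fun h : R => scal (/ h) (minus (T h x) x))
      (at_right 0) (locally y).

(* Pointwise Riemann integral, i.e. the integral in the strong operator
   topology. *)
Definition average {X : CompleteNormedModule R_AbsRing}
    (T : R -> X -> X) (t : R) (x : X) : X :=
  scal (/ t) (RInt (fun s => T s x) 0 t).

(* Main.v *)
(* A Markov operator maps the unit ball of the base norm to itself and preserves
   [f], so both semigroups are contractive and differences of states stay in the
   kernel of [f].  For [z] in the common domain of the generators, the right
   derivative of [s |-> norm (T s z - S s z)] is at most [norm (B (S s z))], which
   gives [norm (T s z - S s z) <= s * norm B * norm z]; density of the domain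
   extends this to every [z].  For a state [z],
     [T (t0 + s) z - S (t0 + s) z
        = T t0 (T s z - S s z) + (T t0 - S t0) (S s z)]
   yields the recurrence [a (t0 + s) <= t0 * c + delta * a s] with
   [c = norm B].  The norm of the integral of [r |-> T r (x - z)] over [0, s]
   satisfies the same recurrence with [c = norm (x - z)].  The recurrence is solved
   by the factor in the theorem, and it remains to integrate and divide by [t]. *)
Require Import Defs.
From Stdlib Require Import Reals Lra ssreflect.
From Coquelicot Require Import Coquelicot.
Open Scope R_scope.

(** * Identities and norm inequalities in normed modules *)

Lemma minus_minus_r {G : AbelianGroup} (a b c : G) :
  minus (minus a c) (minus b c) = minus a b.
Proof.
unfold minus; rewrite (opp_plus b) opp_opp -plus_assoc.
now rewrite (plus_comm (opp b)) (plus_assoc (opp c)) plus_opp_l plus_zero_l.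
Qed.

Lemma minus_exchange {G : AbelianGroup} (a b c d : G) :
  plus a b = plus c d -> minus b c = minus d a.
Proof.
intros E.
assert (K : forall u v : G, plus (opp u) (plus u v) = v).
  now intros u v; rewrite plus_assoc plus_opp_l plus_zero_l.
unfold minus; rewrite -(K a b) E (plus_comm c d) (plus_comm (opp a)).
rewrite -!plus_assoc (plus_comm (opp a) (opp c)) (plus_assoc c).
now rewrite plus_opp_r plus_zero_l.
Qed.

(** The inequality opposite to [norm_scal] comes from [norm_scal] itself, applied to the scalar
    [/ k] and the vector [scal k x]. *)
Lemma norm_scal_abs {V : NormedModule R_AbsRing} (k : R) (x : V) :
  norm (scal k x) = Rabs k * norm x.
Proof.
destruct (Req_dec k 0) as [->|Hk].
  replace (scal 0 x) with (@zero V) by (symmetry; apply (scal_zero_l x)).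
  rewrite norm_zero Rabs_R0; ring.
apply Rle_antisym; [apply (norm_scal k x)|].
assert (Hk' : 0 < Rabs k) by now apply Rabs_pos_lt.
pose proof (norm_scal (/ k) (scal k x)) as H; rewrite scal_assoc in H.
change (norm (scal (/ k * k) x) <= Rabs (/ k) * norm (scal k x)) in H.
rewrite Rinv_l in H; try exact Hk.
replace (scal 1 x) with x in H by (symmetry; apply (scal_one x)).
rewrite Rabs_inv in H; apply (Rmult_le_compat_l (Rabs k)) in H; [|lra].
rewrite -Rmult_assoc in H; rewrite Rinv_r in H; lra.
Qed.

Lemma norm_minus_triangle {V : NormedModule R_AbsRing} (r x y : V) :
  norm (minus x y) <= norm (minus x r) + norm (minus r y).
Proof.
rewrite (minus_trans r); apply norm_triangle.
Qed.

Lemma norm_minus_sym {V : NormedModule R_AbsRing} (x y : V) :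
  norm (minus x y) = norm (minus y x).
Proof.
now rewrite -norm_opp opp_minus.
Qed.

(** * Vector-valued Riemann integrals, one-sided limits and a Dini derivative bound *)

Lemma Riemann_sum_linear {U V : NormedModule R_AbsRing} (L : U -> V)
  (g : R -> U) (ptd : SF_seq) :
  is_linear L -> Riemann_sum (fun s => L (g s)) ptd = L (Riemann_sum g ptd).
Proof.
intros HL; revert ptd.
refine (SF_cons_ind _ _ _); [intros x0|intros h s IH].
  symmetry; apply (linear_zero L HL).
rewrite !Riemann_sum_cons IH (linear_plus L HL).
now rewrite -(linear_scal L HL).
Qed.

Lemma is_RInt_linear {U V : NormedModule R_AbsRing} (L : U -> V)
  (g : R -> U) (a b : R) (l : U) :
  is_linear L -> is_RInt g a b l -> is_RInt (fun s => L (g s)) a b (L l).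
Proof.
intros HL Hg; unfold is_RInt.
apply filterlim_ext with
  (fun ptd => L (scal (sign (b - a)) (Riemann_sum g ptd))).
  now intros ptd; rewrite (Riemann_sum_linear L g ptd HL) (linear_scal L HL).
exact (filterlim_comp _ _ _ _ L _ _ _ Hg (linear_cont L l HL)).
Qed.

Lemma RInt_linear {U V : CompleteNormedModule R_AbsRing} (L : U -> V)
  (g : R -> U) (a b : R) :
  is_linear L -> ex_RInt g a b -> RInt (fun s => L (g s)) a b = L (RInt g a b).
Proof.
intros HL Hg; apply is_RInt_unique, is_RInt_linear; [exact HL|].
now apply (RInt_correct g).
Qed.

Lemma at_right_0_eps (Q : R -> Prop) :
  at_right 0 Q <-> exists eta, 0 < eta /\ forall h, 0 < h < eta -> Q h.
Proof.
split.
  intros [eta H]; exists eta; split; [apply cond_pos|]; intros h Hh; apply H; [|lra].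
  change (Rabs (h - 0) < eta); rewrite Rabs_right; lra.
intros [eta [He H]]; exists (mkposreal eta He); intros h Hh Hp; apply H.
change (Rabs (h - 0) < eta) in Hh; rewrite Rabs_right in Hh; lra.
Qed.

Lemma filterlim_minus_fct {T : Type} {F : (T -> Prop) -> Prop} {FF : Filter F}
  {V : NormedModule R_AbsRing} (g1 g2 : T -> V) (l1 l2 : V) :
  filterlim g1 F (locally l1) -> filterlim g2 F (locally l2) ->
  filterlim (fun h => minus (g1 h) (g2 h)) F (locally (minus l1 l2)).
Proof.
intros H1 H2; unfold minus.
eapply filterlim_comp_2; [exact H1| |apply filterlim_plus].
exact (filterlim_comp _ _ _ _ _ _ _ _ H2 (filterlim_opp l2)).
Qed.

Lemma continuous_iff_eps {V : NormedModule R_AbsRing} (g : R -> V) (a : R) :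
  continuous g a <-> forall eps, 0 < eps -> exists eta, 0 < eta /\
    forall r, Rabs (r - a) < eta -> norm (minus (g r) (g a)) < eps.
Proof.
unfold continuous; rewrite (filterlim_locally_ball_norm g (g a)); split.
  intros H eps He; destruct (H (mkposreal eps He)) as [eta Hd].
  exists eta; split; [apply cond_pos|exact Hd].
intros H [eps He]; destruct (H eps He) as [eta [Hd H']].
exists (mkposreal eta Hd); exact H'.
Qed.

(** The difference between the mean and [g a] is the mean of [g r - g a] over [[a, a + h]], which
    continuity at [a] makes small. *)
Lemma RInt_mean_right {V : CompleteNormedModule R_AbsRing} (g : R -> V) (a : R) :
  (forall r, continuous g r) ->
  filterlim (fun h => scal (/ h) (RInt g a (a + h))) (at_right 0)
    (locally (g a)).
Proof.
intros Hg; apply (filterlim_locally_ball_norm _ (g a)); intros [eps He].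
destruct (proj1 (continuous_iff_eps g a) (Hg a) (eps / 2)) as [eta [Hd H]]; [lra|].
apply at_right_0_eps; exists eta; split; [exact Hd|]; intros h Hh.
unfold ball_norm; simpl.
assert (Hi : ex_RInt g a (a + h)) by (apply (ex_RInt_continuous g); auto).
assert (E : minus (scal (/ h) (RInt g a (a + h))) (g a)
            = scal (/ h) (RInt (fun r => minus (g r) (g a)) a (a + h))).
  rewrite (RInt_minus g (fun _ => g a)); try (auto; apply ex_RInt_const).
  rewrite RInt_const scal_minus_distr_l scal_assoc.
  f_equal; rewrite -{1}(scal_one (g a)); f_equal.
  change (1 = / h * (a + h - a)); field; lra.
rewrite E norm_scal_abs Rabs_right; try (apply Rle_ge, Rlt_le, Rinv_0_lt_compat; lra).
assert (Hn : norm (RInt (fun r => minus (g r) (g a)) a (a + h)) <= (a + h - a) * (eps / 2)).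
  eapply norm_RInt_le_const; [lra| |apply (RInt_correct (fun r => minus (g r) (g a)))].
    intros r Hr; apply Rlt_le, H; rewrite Rabs_right; lra.
  apply (ex_RInt_minus g (fun _ => g a)); [exact Hi|apply ex_RInt_const].
apply Rle_lt_trans with (/ h * ((a + h - a) * (eps / 2))).
  apply Rmult_le_compat_l; [apply Rlt_le, Rinv_0_lt_compat; lra|exact Hn].
replace (/ h * ((a + h - a) * (eps / 2))) with (eps / 2) by (field; lra); lra.
Qed.

(** If the bound failed, [F] would end above a line of slope slightly larger than [M]. At the last
    point where [F] is not above that line, the hypothesis on right increments keeps [F] below it a
    little longer. *)
Lemma right_Dini_bound (F : R -> R) (M b : R) :
  0 <= b -> (forall r, continuous F r) ->
  (forall r eps, 0 <= r -> 0 < eps ->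
     at_right 0 (fun h => F (r + h) <= F r + (M + eps) * h)) ->
  F b <= F 0 + M * b.
Proof.
intros Hb Fc HF.
apply Rnot_lt_le; intros Hlt.
destruct (Req_dec b 0) as [->|Hb0]; [lra|].
(* With this slope increment the line absorbs only half of the excess of [F b], so that [G b] stays
   positive. *)
set (eps := (F b - (F 0 + M * b)) / (2 * b)).
assert (He : 0 < eps) by (apply Rdiv_lt_0_compat; lra).
set (G := fun r => F r - (F 0 + (M + eps) * r)).
assert (HGb : 0 < G b).
  unfold G; replace ((M + eps) * b) with (M * b + (F b - (F 0 + M * b)) / 2)
    by (unfold eps; field; lra); lra.
assert (Gc : forall c e, 0 < e -> exists eta, 0 < eta /\
    forall r, Rabs (r - c) < eta -> Rabs (G r - G c) < e).
  intros c; apply (proj1 (continuous_iff_eps (V := R_NormedModule) G c)).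
  unfold G; apply (continuous_minus F (fun r => F 0 + (M + eps) * r)); [apply Fc|].
  apply continuity_pt_filterlim; reg.
destruct (completeness (fun r => 0 <= r <= b /\ G r <= 0)) as [c [Hub Hlub]].
- exists b; intros r Hr; lra.
- exists 0; split; [lra|]; unfold G; lra.
- assert (Hc : 0 <= c <= b).
    split; [apply Hub; split; [lra|]; unfold G; lra|].
    apply Hlub; intros r Hr; lra.
  (* The supremum is attained: if [G c] were positive, [G] would be positive just left of [c], and
     [c - eta] would already be an upper bound. *)
  assert (HGc : G c <= 0).
    apply Rnot_lt_le; intros Hp.
    destruct (Gc c (G c) Hp) as [eta [Hd H]].
    assert (c <= c - eta); [|lra].
    apply Hlub; intros r [Hr Hr'].
    apply Rnot_lt_le; intros Hr2.
    assert (r <= c) by (apply Hub; auto).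
    assert (HR : Rabs (r - c) < eta) by (apply Rabs_def1; lra).
    apply H in HR; apply Rabs_def2 in HR; lra.
  destruct (Req_dec c b) as [->|Hcb]; [lra|].
  destruct (proj1 (at_right_0_eps _) (HF c eps (proj1 Hc) He)) as [eta [Hd H]].
  (* The step stays below [eta], where the increment bound holds, and [c + h] stays in [[0, b]]; so
     [c + h] belongs to the set whose supremum is [c]. *)
  set (h := Rmin (eta / 2) (b - c)).
  assert (Hh : 0 < h < eta /\ h <= b - c).
    unfold h; pose proof (Rmin_l (eta / 2) (b - c)); pose proof (Rmin_r (eta / 2) (b - c)).
    assert (0 < Rmin (eta / 2) (b - c)) by (apply Rmin_glb_lt; lra); lra.
  pose proof (H h (proj1 Hh)) as Hs.
  assert (c + h <= c); [|lra].
  apply Hub; split; [lra|]; unfold G in *; lra.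
Qed.

(** * Contraction semigroups: orbits, integrals and generators *)

(** The setting for orbits, generators and perturbation; [markov_contraction_semigroup] brings
    Markov semigroups under it. Since [is_linear] includes boundedness, each [T t] passes through
    integrals and limits. *)
Record contraction_semigroup {X : NormedModule R_AbsRing} (T : R -> X -> X)
    : Prop := {
  cs_linear : forall t, 0 <= t -> is_linear (T t);
  cs_le : forall t x, 0 <= t -> norm (T t x) <= norm x;
  cs_zero : forall x, T 0 x = x;
  cs_add : forall t s x, 0 <= t -> 0 <= s -> T (t + s) x = T t (T s x);
  cs_cont : forall x,
    filterlim (fun t => norm (minus (T t x) x)) (at_right 0) (locally 0)
}.

(* The orbit is extended to negative times by [Rabs], so that the two-sided
   continuity lemmas of the library apply at time [0] too. *)
Lemma orbit_continuous {X : NormedModule R_AbsRing} (T : R -> X -> X) (x : X) (a : R) :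
  contraction_semigroup T -> continuous (fun r => T (Rabs r) x) a.
Proof.
intros HT; apply continuous_iff_eps; intros eps He.
destruct (proj1 (at_right_0_eps _)
  (proj1 (filterlim_locally_ball_norm (U := R_NormedModule) _ 0) (cs_cont T HT x) (mkposreal eps He)))
  as [eta [Hd H]].
exists eta; split; [exact Hd|].
(* [T v x - T u x] is [T u] applied to [T (v - u) x - x], so contractivity reduces continuity at any
   time to continuity at 0. *)
assert (Hd' : forall u v, 0 <= u <= v -> v - u < eta -> norm (minus (T v x) (T u x)) < eps).
  intros u v Huv Hv.
  replace v with (u + (v - u)) by ring.
  rewrite (cs_add T HT); try lra.
  rewrite -(linear_minus (T u)); try (apply (cs_linear T HT); lra).
  apply Rle_lt_trans with (1 := cs_le T HT u _ (proj1 Huv)).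
  destruct (Req_dec (v - u) 0) as [->|Hn].
    now rewrite (cs_zero T HT) minus_eq_zero norm_zero.
  assert (Hh : 0 < v - u < eta) by lra.
  specialize (H _ Hh); unfold ball_norm in H; simpl in H.
  change (Rabs (norm (minus (T (v - u) x) x) - 0) < eps) in H.
  apply Rabs_def2 in H; lra.
intros r Hr; pose proof (Rabs_triang_inv2 r a) as H2.
pose proof (Rabs_pos r); pose proof (Rabs_pos a).
assert (H3 : Rabs (Rabs r - Rabs a) < eta) by lra.
apply Rabs_def2 in H3.
destruct (Rle_dec (Rabs a) (Rabs r)) as [Hle|Hle].
  apply Hd'; lra.
rewrite norm_minus_sym; apply Hd'; lra.
Qed.

Lemma orbit_ex_RInt {X : CompleteNormedModule R_AbsRing} (T : R -> X -> X) (x : X) (a b : R) :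
  contraction_semigroup T -> 0 <= a -> 0 <= b -> ex_RInt (fun r => T r x) a b.
Proof.
intros HT Ha Hb; apply ex_RInt_ext with (fun r => T (Rabs r) x).
  intros r Hr; rewrite Rabs_right; [reflexivity|].
  pose proof (Rmin_glb _ _ _ Ha Hb); lra.
apply (ex_RInt_continuous (fun r => T (Rabs r) x)); intros r _.
exact (orbit_continuous T x r HT).
Qed.

Lemma orbit_RInt_shift {X : CompleteNormedModule R_AbsRing} (T : R -> X -> X) (x : X) (a b : R) :
  contraction_semigroup T -> 0 <= a -> 0 <= b ->
  RInt (fun r => T r x) a (a + b) = T a (RInt (fun r => T r x) 0 b).
Proof.
intros HT Ha Hb.
rewrite -RInt_linear; [|now apply (cs_linear T HT)|now apply orbit_ex_RInt; try lra].
pose proof (RInt_comp_lin (fun r => T r x) 1 a 0 b) as H.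
replace (1 * 0 + a) with a in H by ring; replace (1 * b + a) with (a + b) in H by ring.
rewrite -H; try (apply orbit_ex_RInt; lra || auto).
apply RInt_ext; intros r Hr; rewrite Rmin_left in Hr; try lra.
etransitivity; [apply (scal_one (T (1 * r + a) x))|].
rewrite -(cs_add T HT); try lra; f_equal; ring.
Qed.

Lemma filterlim_at_right_0_ext {V : NormedModule R_AbsRing} (g1 g2 : R -> V) (l : V) :
  (forall h, 0 < h -> g1 h = g2 h) ->
  filterlim g1 (at_right 0) (locally l) -> filterlim g2 (at_right 0) (locally l).
Proof.
intros E; apply filterlim_ext_loc, at_right_0_eps.
exists 1; split; [lra|]; intros h Hh; apply E; lra.
Qed.

(** The difference quotient of the integral is the mean of the orbit over [[a, a + h]] minus its
    mean over [[0, h]], and hence tends to [T a x - x]. Such integrals, divided by [a], supply the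
    density of the domain. *)
Lemma orbit_RInt_dom {X : CompleteNormedModule R_AbsRing} (T : R -> X -> X)
  (A : partial_op X) (x : X) (a : R) :
  contraction_semigroup T -> is_generator T A -> 0 <= a ->
  dom A (RInt (fun r => T r x) 0 a).
Proof.
intros HT HA Ha.
set (g := fun r => T (Rabs r) x).
assert (Hg : forall r, continuous g r) by (intros r; exact (orbit_continuous T x r HT)).
assert (Hgi : forall u v, ex_RInt g u v) by (intros; apply (ex_RInt_continuous g); auto).
assert (Eg : forall u v, 0 <= u -> 0 <= v -> RInt (fun r => T r x) u v = RInt g u v).
  intros u v Hu Hv; apply RInt_ext; intros r Hr; unfold g; rewrite Rabs_right; [reflexivity|].
  pose proof (Rmin_glb _ _ _ Hu Hv); lra.
refine (proj1 (proj2 (HA _ (minus (g a) (g 0))) _)).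
apply filterlim_at_right_0_ext with
  (fun h => minus (scal (/ h) (RInt g a (a + h))) (scal (/ h) (RInt g 0 (0 + h)))).
  intros h Hh; rewrite -orbit_RInt_shift; try (lra || auto).
  (* The exchange compares two splittings of the integral over [[0, a + h]], at [a] and at [h]. *)
  rewrite !Eg; try lra; rewrite -scal_minus_distr_l; f_equal; symmetry.
  apply minus_exchange; rewrite Rplus_0_l (RInt_Chasles g); try auto.
  rewrite (RInt_Chasles g); try auto.
  now rewrite Rplus_comm.
exact (filterlim_minus_fct _ _ _ _ (RInt_mean_right g a Hg) (RInt_mean_right g 0 Hg)).
Qed.

(** [T s] commutes with the difference quotients and, being continuous, with their limit. *)
Lemma generator_dom_invariant {X : NormedModule R_AbsRing} (T : R -> X -> X)
  (A : partial_op X) (x : X) (s : R) :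
  contraction_semigroup T -> is_generator T A -> 0 <= s -> dom A x -> dom A (T s x).
Proof.
intros HT HA Hs Hx.
pose proof (cs_linear T HT s Hs) as L.
refine (proj1 (proj2 (HA _ (T s (app A x))) _)).
apply filterlim_at_right_0_ext with (fun h => T s (scal (/ h) (minus (T h x) x))).
  intros h Hh; rewrite (linear_scal _ L) (linear_minus _ _ _ L) -!(cs_add T HT); try lra.
  now rewrite Rplus_comm.
apply filterlim_comp with (2 := linear_cont _ (app A x) L).
now apply HA.
Qed.

(** * Distance between two semigroups whose generators differ by a bounded operator *)

(** The difference at time [r + h] is [T h (T r z - S r z) + (T h - S h) (S r z)]. The first term
    does not increase the norm; the second, divided by [h], tends to [B (S r z)] because [S r z]
    lies in both domains. *)
Lemma semigroup_diff_le_dom {X : CompleteNormedModule R_AbsRing} (S T : R -> X -> X)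
  (A C : partial_op X) (B : X -> X) (b : R) (z : X) (s : R) :
  contraction_semigroup S -> contraction_semigroup T ->
  is_generator S A -> is_generator T C -> (forall x, dom A x <-> dom C x) ->
  (forall x, dom A x -> B x = minus (app C x) (app A x)) ->
  0 <= b -> (forall x, norm (B x) <= b * norm x) ->
  dom A z -> 0 <= s ->
  norm (minus (T s z) (S s z)) <= s * (b * norm z).
Proof.
intros HS HT HA HC Hd HB Hb0 Hb Hz Hs.
pose (F := fun r => norm (minus (T (Rabs r) z) (S (Rabs r) z))).
assert (H : F s <= F 0 + (b * norm z) * s).
  apply right_Dini_bound; [exact Hs| |].
    intros r; apply (continuous_comp (fun r => minus (T (Rabs r) z) (S (Rabs r) z)) norm).
      apply (continuous_minus (fun r => T (Rabs r) z) (fun r => S (Rabs r) z)).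
        exact (orbit_continuous T z r HT).
      exact (orbit_continuous S z r HS).
    exact (filterlim_norm (minus (T (Rabs r) z) (S (Rabs r) z))).
  intros r eps Hr He; unfold F.
  assert (Hy : dom A (S r z)) by (eapply generator_dom_invariant; eauto).
  assert (Hl : filterlim (fun h => norm (minus (scal (/ h) (minus (T h (S r z)) (S r z)))
     (scal (/ h) (minus (S h (S r z)) (S r z))))) (at_right 0) (locally (norm (B (S r z))))).
    rewrite (HB _ Hy).
    refine (filterlim_comp _ _ _ _ norm _ _ _ (filterlim_minus_fct _ _ _ _
      (proj1 (HC _ (app C (S r z))) _) (proj1 (HA _ (app A (S r z))) _))
      (filterlim_norm _)); split; auto; now apply Hd.
  pose proof (proj1 (filterlim_locally_ball_norm (U := R_NormedModule) _ _) Hl (mkposreal eps He)) as Hl'.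
  apply at_right_0_eps in Hl'; destruct Hl' as [eta [He' Hl']].
  apply at_right_0_eps; exists eta; split; [exact He'|]; intros h Hh.
  specialize (Hl' h Hh); unfold ball_norm in Hl'; simpl in Hl'.
  match type of Hl' with norm (minus ?a ?b) < _ => change (Rabs (a - b) < eps) in Hl' end.
  apply Rabs_def2 in Hl'; destruct Hl' as [Hl' _].
  rewrite -scal_minus_distr_l minus_minus_r norm_scal_abs in Hl'.
  rewrite Rabs_right in Hl'; try (apply Rle_ge, Rlt_le, Rinv_0_lt_compat; lra).
  change (/ h * norm (minus (T h (S r z)) (S h (S r z))) - norm (B (S r z)) < eps) in Hl'.
  assert (HBy : norm (B (S r z)) <= b * norm z).
    eapply Rle_trans; [apply Hb|apply Rmult_le_compat_l; [exact Hb0|now apply (cs_le S HS)]].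
  assert (Hn : norm (minus (T h (S r z)) (S h (S r z))) <= (b * norm z + eps) * h).
    replace (norm (minus (T h (S r z)) (S h (S r z))))
      with ((/ h * norm (minus (T h (S r z)) (S h (S r z)))) * h) by (field; lra).
    apply Rmult_le_compat_r; lra.
  rewrite !Rabs_right; try lra.
  rewrite (Rplus_comm r h) (cs_add T HT); try lra.
  rewrite (cs_add S HS); try lra.
  eapply Rle_trans; [exact (norm_minus_triangle (T h (S r z)) _ _)|].
  apply Rplus_le_compat; [|exact Hn].
  rewrite -(linear_minus (T h)); try (apply (cs_linear T HT); lra).
  apply (cs_le T HT); lra.
unfold F in H; rewrite Rabs_R0 (cs_zero T HT) (cs_zero S HS) minus_eq_zero norm_zero in H.
rewrite Rabs_right in H; try lra; lra.
Qed.

Lemma semigroup_diff_le {X : CompleteNormedModule R_AbsRing} (S T : R -> X -> X)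
  (A C : partial_op X) (B : X -> X) (b : R) (z : X) (s : R) :
  contraction_semigroup S -> contraction_semigroup T ->
  is_generator S A -> is_generator T C -> (forall x, dom A x <-> dom C x) ->
  (forall x, dom A x -> B x = minus (app C x) (app A x)) ->
  0 <= b -> (forall x, norm (B x) <= b * norm x) ->
  0 <= s ->
  norm (minus (T s z) (S s z)) <= s * (b * norm z).
Proof.
intros HS HT HA HC Hd HB Hb0 Hb Hs.
pose proof (cs_linear S HS s Hs) as LS; pose proof (cs_linear T HT s Hs) as LT.
apply le_epsilon; intros eps He.
(* An approximation error [e] of [z] by [w] is paid once under [T s], once under [S s], and [s * b]
   times through the norm of [w]. *)
assert (Hk : 0 < 2 + s * b) by (pose proof (Rmult_le_pos _ _ Hs Hb0); lra).
pose proof (RInt_mean_right (fun r => S (Rabs r) z) 0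
  (fun r => orbit_continuous S z r HS)) as Hl.
pose proof (proj1 (filterlim_locally_ball_norm _ _) Hl
  (mkposreal _ (Rdiv_lt_0_compat _ _ He Hk))) as Hl'.
apply at_right_0_eps in Hl'; destruct Hl' as [eta [He' Hl']].
assert (Hh : 0 < eta / 2 < eta) by lra.
specialize (Hl' _ Hh); set (h := eta / 2) in *; unfold ball_norm in Hl'; simpl in Hl'.
rewrite Rabs_R0 (cs_zero S HS) Rplus_0_l in Hl'.
rewrite (RInt_ext _ (fun r => S r z)) in Hl'.
2:{ intros r Hr; rewrite Rmin_left in Hr; [|lra]; rewrite Rabs_right; [reflexivity|lra]. }
set (y := RInt (fun r => S r z) 0 h) in *.
assert (Hy : dom A y) by (apply orbit_RInt_dom; auto; lra).
pose proof (semigroup_diff_le_dom S T A C B b y s HS HT HA HC Hd HB Hb0 Hb Hy Hs) as D.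
set (w := scal (/ h) y) in *.
assert (Dw : norm (minus (T s w) (S s w)) <= s * (b * norm w)).
  unfold w; rewrite (linear_scal _ LS) (linear_scal _ LT) -scal_minus_distr_l !norm_scal_abs.
  assert (K : forall k m v, 0 <= k -> m <= s * (b * v) -> k * m <= s * (b * (k * v))).
    intros k m v Hk' Hm; replace (s * (b * (k * v))) with (k * (s * (b * v))) by ring.
    now apply Rmult_le_compat_l.
  exact (K _ _ _ (Rabs_pos (/ h)) D).
assert (Hzw : norm (minus z w) < eps / (2 + s * b)) by now rewrite norm_minus_sym.
assert (Hw : norm w <= norm z + eps / (2 + s * b)).
  pose proof (norm_triangle_inv w z) as Hi.
  pose proof (Rle_abs (norm w - norm z)); lra.
eapply Rle_trans; [exact (norm_minus_triangle (T s w) _ _)|].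
eapply Rle_trans; [exact (Rplus_le_compat_l _ _ _ (norm_minus_triangle (S s w) _ _))|].
rewrite -(linear_minus _ _ _ LT) -(linear_minus _ _ _ LS).
apply Rle_trans with (eps / (2 + s * b)
  + (s * (b * (norm z + eps / (2 + s * b))) + eps / (2 + s * b))).
  apply Rplus_le_compat; [|apply Rplus_le_compat].
  - exact (Rle_trans _ _ _ (cs_le T HT s (minus z w) Hs) (Rlt_le _ _ Hzw)).
  - apply (Rle_trans _ _ _ Dw), Rmult_le_compat_l; [exact Hs|].
    now apply Rmult_le_compat_l.
  - exact (Rle_trans _ _ _ (cs_le S HS s (minus w z) Hs) (Rlt_le _ _ Hl')).
apply Req_le; field; lra.
Qed.

(** * Operator norms, and Markov operators in the base norm *)

(** The bound [M] excludes the supremum [p_infty], which [real] would send to 0. It also gives [T x]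
    norm 0 when [x] has norm 0, a case that the supremum leaves out. *)
Lemma op_norm_on_spec {X : NormedModule R_AbsRing} (N : X -> Prop) (T : X -> X) (M : R) :
  (forall x, norm (T x) <= M * norm x) ->
  0 <= op_norm_on N T /\ forall x, N x -> norm (T x) <= op_norm_on N T * norm x.
Proof.
intros HM; unfold op_norm_on.
set (E := fun r => exists x, N x /\ x <> zero /\ r = norm (T x) / norm x).
destruct (Lub_Rbar_correct E) as [Hub Hlub].
assert (HE : forall r, E r -> 0 <= r <= M).
  intros r [x [_ [Hx ->]]].
  assert (Hp : 0 < norm x).
    destruct (norm_ge_0 x) as [H|H]; [exact H|].
    now elim Hx; apply norm_eq_zero.
  split; [apply Rdiv_le_0_compat; [apply norm_ge_0|exact Hp]|].
  now apply Rle_div_l.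
assert (HL : forall r, E r -> r <= real (Lub_Rbar E)).
  intros r Hr; specialize (Hub r Hr); specialize (Hlub (Finite M)).
  assert (Rbar_le (Lub_Rbar E) M) by (apply Hlub; intros u Hu; apply HE, Hu).
  now destruct (Lub_Rbar E).
split.
  (* A negative supremum would force [E], whose elements are nonnegative, to be empty; then
     [m_infty] would be a smaller upper bound. *)
  specialize (Hlub m_infty).
  destruct (Lub_Rbar E) as [l| |]; simpl; try lra.
  apply Rnot_lt_le; intros Hl; apply Hlub.
  intros r Hr; specialize (HL r Hr); specialize (HE r Hr); simpl in HL; lra.
intros x Hx.
pose proof (norm_ge_0 x) as [Hp|Hp].
  apply Rle_div_l; [exact Hp|]; apply HL; exists x; split; [exact Hx|split; [|reflexivity]].
  intros ->; rewrite norm_zero in Hp; lra.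
specialize (HM x); rewrite -Hp in HM |- *; lra.
Qed.

Section MarkovContraction.

Context {X : CompleteNormedModule R_AbsRing} (P : X -> Prop) (f : X -> R).
Context (hX : abstract_state_space X P f).

Lemma state_norm_greatest (x : X) (m : R) :
  (forall l u, 0 <= l -> base_ball P f u -> x = scal l u -> m <= l) -> m <= norm x.
Proof.
intros H; apply (proj2 (ass_norm X P f hX x) (Finite m)).
intros l [Hl [u [Hu E]]]; exact (H l u Hl Hu E).
Qed.

Lemma state_norm_le (l : R) (u : X) :
  0 <= l -> base_ball P f u -> norm (scal l u) <= l.
Proof.
intros Hl Hu; apply (proj1 (ass_norm X P f hX (scal l u)) l).
split; [exact Hl|now exists u].
Qed.

Lemma state_norm_base (x : X) : base P f x -> norm x <= 1.
Proof.
intros Hx; rewrite -(scal_one x); apply state_norm_le; [simpl; lra|].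
now intros D _ HD; apply HD; left.
Qed.

Lemma linear_map_opp {V : NormedModule R_AbsRing} (L : X -> V) (x : X) :
  linear_map L -> L (opp x) = opp (L x).
Proof.
intros [_ H]; rewrite -(scal_opp_one x) -(scal_opp_one (L x)); apply H.
Qed.

(** The set where [Rabs (f v) <= 1] is convex and contains the base and its negative, hence
    [base_ball]. This boundedness lets [f] pass through integrals. *)
Lemma state_functional_le (x : X) : Rabs (f x) <= norm x.
Proof.
pose proof (ass_linear X P f hX) as [Fp Fs].
apply state_norm_greatest; intros l u Hl Hu ->.
assert (H : Rabs (f u) <= 1).
  apply (Hu (fun v => Rabs (f v) <= 1)).
    intros y v a Hy Hv Ha; rewrite Fp !Fs.
    change (Rabs (a * f y + (1 - a) * f v) <= 1).
    apply Rabs_le_between in Hy; apply Rabs_le_between in Hv; apply Rabs_le_between.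
    split; nra.
  intros y [[_ H]|[_ H]]; [rewrite H Rabs_R1; lra|].
  rewrite linear_map_opp in H; try exact (conj Fp Fs).
  change (- f y = 1) in H; replace (f y) with (-1) by lra.
  rewrite Rabs_left; lra.
rewrite Fs; change (Rabs (l * f u) <= l).
rewrite Rabs_mult (Rabs_right l); try lra; nra.
Qed.

Lemma state_functional_is_linear : is_linear (f : X -> R_NormedModule).
Proof.
destruct (ass_linear X P f hX) as [Fp Fs]; split; [exact Fp|exact Fs|].
exists 1; split; [lra|]; intros x; rewrite Rmult_1_l; apply state_functional_le.
Qed.

(** The preimage of [base_ball] under [T] is convex and contains the base and its negative, so it
    contains [base_ball]. *)
Lemma markov_norm_le (T : X -> X) (x : X) : markov P f T -> norm (T x) <= norm x.
Proof.
intros [[Tp Ts] [_ Tb]]; apply state_norm_greatest; intros l u Hl Hu ->.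
rewrite Ts; apply state_norm_le; [exact Hl|].
apply (Hu (fun v => base_ball P f (T v))).
  intros y v a Hy Hv Ha; rewrite Tp !Ts.
  intros D HD HE; apply HD; [now apply Hy|now apply Hv|exact Ha].
intros y Hy D _ HD; apply HD; rewrite -linear_map_opp; try (split; auto).
destruct Hy; auto.
Qed.

(** A nonzero positive vector is a positive multiple of a state, and [T] maps states to states; the
    generating cone extends the equality to all of [X]. *)
Lemma markov_functional (T : X -> X) (x : X) : markov P f T -> f (T x) = f x.
Proof.
intros [[Tp Ts] [_ Tb]].
pose proof state_functional_is_linear as F.
assert (L : linear_map T) by (split; auto).
assert (HP : forall y, P y -> f (T y) = f y).
  intros y Hy.
  destruct (Req_dec (f y) 0) as [H0|H0].
    assert (E : norm y = 0).
      destruct (Req_dec (norm y) 0) as [E|E]; [exact E|].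
      assert (Hy0 : y <> zero) by (intros ->; apply E; exact (norm_zero (V := X))).
      pose proof (ass_pos X P f hX y Hy Hy0); lra.
    apply norm_eq_zero in E; subst y; f_equal.
    pose proof (Ts 0 zero) as E0; change 0 with (@zero R_AbsRing) in E0.
    now rewrite !scal_zero_l in E0.
  assert (Hp : 0 < f y).
    apply (ass_pos X P f hX y Hy); intros ->; apply H0, (linear_zero _ F).
  assert (Hb : base P f (scal (/ f y) y)).
    split; [apply (ass_cone X P f hX); [apply Rlt_le, Rinv_0_lt_compat, Hp|exact Hy]|].
    rewrite (linear_scal _ F); now apply Rinv_l.
  apply Tb in Hb; destruct Hb as [_ Hb].
  rewrite Ts (linear_scal _ F) in Hb; change (/ f y * f (T y) = 1) in Hb.
  apply (Rmult_eq_reg_l (/ f y)); [|now apply Rinv_neq_0_compat].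
  now rewrite Hb Rinv_l.
destruct (ass_generating X P f hX x) as [y [v [Hy [Hv ->]]]].
unfold minus; rewrite Tp (linear_map_opp T v L).
rewrite !(linear_plus _ F) !(linear_opp _ _ F).
change (@eq R) with (@eq (AbelianGroup.sort R_AbelianGroup)); f_equal; [now apply HP|f_equal; now apply HP].
Qed.

Lemma markov_contraction_semigroup (T : R -> X -> X) :
  C0_markov_semigroup P f T -> contraction_semigroup T.
Proof.
intros HT; split.
- intros t Ht; destruct (sg_markov P f T HT t Ht) as [[Tp Ts] HM].
  split; [exact Tp|exact Ts|exists 1; split; [lra|]].
  intros x; rewrite Rmult_1_l; apply markov_norm_le, (sg_markov P f T HT t Ht).
- intros t x Ht; now apply markov_norm_le, (sg_markov P f T HT t Ht).
- exact (sg_zero P f T HT).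
- exact (sg_add P f T HT).
- exact (sg_cont P f T HT).
Qed.

End MarkovContraction.

(** * The delayed recurrence and the estimate for averages *)

(* The coefficient of [c] on the right solves [G (n+1) = t0 + d * G n] with [G 0 = q]. *)
Lemma delayed_recurrence_bound (a : R -> R) (t0 c d : R) (n : nat) (q s : R) :
  0 < t0 -> 0 <= c -> 0 <= d < 1 ->
  (forall s, 0 <= s <= t0 -> a s <= s * c) ->
  (forall s, 0 <= s -> a (t0 + s) <= t0 * c + d * a s) ->
  0 <= q <= t0 -> 0 <= s <= q + INR n * t0 ->
  a s <= (t0 * (1 - d ^ n) / (1 - d) + d ^ n * q) * c.
Proof.
intros Ht0 Hc Hd H0 H1 Hq; revert s; induction n as [|n IH]; intros s Hs.
  simpl in *; replace (t0 * (1 - 1) / (1 - d) + 1 * q) with q by (field; lra).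
  apply Rle_trans with (s * c); [apply H0; lra|apply Rmult_le_compat_r; lra].
rewrite S_INR in Hs.
set (G := t0 * (1 - d ^ n) / (1 - d) + d ^ n * q) in *.
replace (t0 * (1 - d ^ S n) / (1 - d) + d ^ S n * q) with (t0 + d * G)
  by (unfold G; simpl; field; lra).
assert (HG : 0 <= G).
  assert (Hp : 0 <= d ^ n <= 1).
    split; [apply pow_le; lra|rewrite -(pow1 n); apply pow_incr; lra].
  apply Rplus_le_le_0_compat; [apply Rdiv_le_0_compat; nra|nra].
(* For [s <= t0] the initial bound suffices, because the new coefficient [t0 + d * G] is at least
   [t0]. *)
destruct (Rle_dec s t0) as [Hle|Hle].
  apply Rle_trans with (s * c); [apply H0; lra|apply Rmult_le_compat_r; nra].
replace s with (t0 + (s - t0)) by ring.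
eapply Rle_trans; [apply H1; lra|].
assert (Hs' : 0 <= s - t0 <= q + INR n * t0) by lra.
pose proof (Rmult_le_compat_l d _ _ (proj1 Hd) (IH _ Hs')); lra.
Qed.

Theorem theorem3p11
  (X : CompleteNormedModule R_AbsRing) (P : X -> Prop) (f : X -> R)
  (hX : abstract_state_space X P f)
  (S T : R -> X -> X)
  (hS : C0_markov_semigroup P f S) (hT : C0_markov_semigroup P f T)
  (A C : partial_op X)
  (hA : is_generator S A) (hC : is_generator T C)
  (hdom : forall x : X, dom A x <-> dom C x)
  (B : X -> X) (hB : is_linear B)
  (hBAC : forall x : X, dom A x -> B x = minus (app C x) (app A x))
  (rho t0 : R) (hrho : 0 <= rho < 1) (ht0 : 0 < t0)
  (hdelta : dobrushin f (T t0) <= rho)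
  (x z : X) (hx : base P f x) (hz : base P f z)
  (t : R) (ht : 0 < t) :
  let d := dobrushin f (T t0) in
  let n := Int_part (t / t0) in
  norm (minus (average T t x) (average S t z)) <=
    (t0 * (1 - powerRZ d n) / (1 - d) + powerRZ d n * (t - t0 * IZR n)) *
    (op_norm B + norm (minus x z) / t).
Proof.
intros d n.
pose proof (markov_contraction_semigroup P f hX S hS) as cS.
pose proof (markov_contraction_semigroup P f hX T hT) as cT.
pose proof (state_functional_is_linear P f hX) as F.
assert (HfT : forall s y, 0 <= s -> f (T s y) = f y) by
  (intros s y Hs; exact (markov_functional P f hX _ y (sg_markov P f T hT s Hs))).
assert (HfS : forall s y, 0 <= s -> f (S s y) = f y) by
  (intros s y Hs; exact (markov_functional P f hX _ y (sg_markov P f S hS s Hs))).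
assert (Hfm : forall u v, f u = f v -> f (minus u v) = 0).
  intros u v E; rewrite (linear_minus _ _ _ F) E.
  change (f v - f v = 0); ring.
destruct (op_norm_on_spec (fun y => f y = 0) (T t0) 1) as [Hd0 Hd].
  intros y; rewrite Rmult_1_l; apply (cs_le T cT); lra.
fold (dobrushin f (T t0)) in Hd0, Hd; fold d in Hd0, Hd, hdelta.
destruct (linear_norm B hB) as [M [_ HM]].
destruct (op_norm_on_spec (fun _ => True) B M HM) as [Hb0 Hb].
fold (op_norm B) in Hb0, Hb; set (b := op_norm B) in *.
assert (Hdiff : forall y s, norm y <= 1 -> 0 <= s -> norm (minus (T s y) (S s y)) <= s * b).
  intros y s Hy Hs.
  eapply Rle_trans;
    [apply (semigroup_diff_le S T A C B b); auto|apply Rmult_le_compat_l; nra].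
assert (Hz1 : norm z <= 1) by now apply (state_norm_base P f hX).
assert (Htt0 : 0 < t / t0) by now apply Rdiv_lt_0_compat.
destruct (base_Int_part (t / t0)) as [Hn1 Hn2]; fold n in Hn1, Hn2.
(* Nonnegativity of [n] turns [powerRZ d n] into the natural power [d ^ k], which is 1 for [k = 0]
   even if [d = 0]. *)
assert (Hn : (0 <= n)%Z) by (apply Z.lt_succ_r, lt_IZR; rewrite succ_IZR; lra).
destruct (IZN n Hn) as [k Hk]; rewrite Hk -pow_powerRZ -INR_IZR_INZ.
rewrite Hk -INR_IZR_INZ in Hn1 Hn2.
set (q := t - t0 * INR k).
assert (Hq : 0 <= q <= t0).
  assert (t = t / t0 * t0) by (field; lra); unfold q; split; nra.
set (G := t0 * (1 - d ^ k) / (1 - d) + d ^ k * q).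
(* With [q] the remainder of [t] modulo [t0], the range of the recurrence bound is all of [[0, t]],
   so the same [G] serves every time to be integrated over. *)
assert (HG : forall a c s, 0 <= c ->
  (forall s, 0 <= s <= t0 -> a s <= s * c) ->
  (forall s, 0 <= s -> a (t0 + s) <= t0 * c + d * a s) ->
  0 <= s <= t -> a s <= G * c).
  intros a c s Hc Ha1 Ha2 Hs; apply delayed_recurrence_bound; auto; [lra|].
  unfold q; lra.
set (w := minus x z).
assert (iT : forall y s, 0 <= s -> ex_RInt (fun r => T r y) 0 s) by
  (intros; apply orbit_ex_RInt; auto; lra).
assert (iS : forall y s, 0 <= s -> ex_RInt (fun r => S r y) 0 s) by
  (intros; apply orbit_ex_RInt; auto; lra).
assert (HI : norm (RInt (fun r => T r w) 0 t) <= G * norm w).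
  apply (HG (fun s => norm (RInt (fun r => T r w) 0 s))); [apply norm_ge_0| | |lra].
    intros s Hs; replace s with (s - 0) at 2 by ring.
    eapply norm_RInt_le_const; [lra| |apply (RInt_correct (fun r => T r w)), iT; lra].
    intros r Hr; apply (cs_le T cT); lra.
  intros s Hs.
  rewrite -(RInt_Chasles (fun r => T r w) 0 t0); try (apply orbit_ex_RInt; auto; lra).
  rewrite orbit_RInt_shift; try (auto; lra).
  eapply Rle_trans; [exact (norm_triangle _ _)|apply Rplus_le_compat].
    replace t0 with (t0 - 0) at 2 by ring.
    eapply norm_RInt_le_const; [lra| |apply (RInt_correct (fun r => T r w)), iT; lra].
    intros r Hr; apply (cs_le T cT); lra.
  (* The remaining integral lies in the kernel of [f]: [f] passes inside, and [f (T r w)] is 0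
     because [x] and [z] are both states. *)
  apply Hd.
  rewrite -(RInt_linear (V := R_CompleteNormedModule) f _ _ _ F (iT w s Hs)).
  rewrite (RInt_ext _ (fun _ => 0)).
    rewrite RInt_const; apply Rmult_0_r.
  intros r Hr; rewrite Rmin_left in Hr; try lra; rewrite HfT; try lra.
  apply Hfm; destruct hx, hz; congruence.
assert (HJ : forall s, 0 <= s <= t -> norm (minus (T s z) (S s z)) <= G * b).
  intros s Hs; apply (HG (fun s => norm (minus (T s z) (S s z)))); auto.
    intros r Hr; apply Hdiff; lra.
  intros r Hr.
  rewrite (cs_add T cT); try lra.
  rewrite (cs_add S cS); try lra.
  eapply Rle_trans; [exact (norm_minus_triangle (T t0 (S r z)) _ _)|].
  rewrite Rplus_comm; apply Rplus_le_compat.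
    apply Hdiff; [|lra].
    eapply Rle_trans; [apply (cs_le S cS); lra|exact Hz1].
  rewrite -(linear_minus (T t0)); try (apply (cs_linear T cT); lra).
  now apply Hd, Hfm; rewrite HfT; [rewrite HfS|].
unfold average; rewrite -scal_minus_distr_l norm_scal_abs.
rewrite Rabs_right; try (apply Rle_ge, Rlt_le, Rinv_0_lt_compat, ht).
(* The intermediate integral of [T r z] separates the change of initial state, bounded by [HI], from
   the change of semigroup, bounded by integrating [HJ]. *)
eapply Rle_trans; [apply Rmult_le_compat_l, (norm_minus_triangle (RInt (fun r => T r z) 0 t));
  apply Rlt_le, Rinv_0_lt_compat, ht|].
rewrite -!RInt_minus; try (apply iT || apply iS; lra).
rewrite (RInt_ext (fun r => minus (T r x) (T r z)) (fun r => T r w)).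
2:{ intros r Hr; rewrite Rmin_left in Hr; [|lra]; unfold w.
    rewrite (linear_minus (T r)); [reflexivity|apply (cs_linear T cT); lra]. }
assert (HK : norm (RInt (fun r => minus (T r z) (S r z)) 0 t) <= (t - 0) * (G * b)).
  eapply norm_RInt_le_const; [lra|exact HJ|].
  apply (RInt_correct (fun r => minus (T r z) (S r z))).
  apply (ex_RInt_minus (fun r => T r z) (fun r => S r z)); [apply iT|apply iS]; lra.
replace (G * (b + norm w / t)) with (/ t * (G * norm w + (t - 0) * (G * b))) by (field; lra).
apply Rmult_le_compat_l; [apply Rlt_le, Rinv_0_lt_compat, ht|].
exact (Rplus_le_compat _ _ _ _ HI HK).
Qed.
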